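(* (i) If a simple 3-dimensional polytope $\mathcal{P}$ has a facet-Hamiltonian cycle, then it has a facet-Hamiltonian path. (ii) There exists a (non-simple) 3-dimensional polytope which has a facet-Hamiltonian cycle but no facet-Hamiltonian path.
   Context: The skeleton of a polytope is the graph formed by its vertices and edges. A cycle (respectively path) $C$ in the skeleton of a polytope is facet-Hamiltonian if for every facet $f$ of the polytope, the intersection $f\cap C$ is nonempty and connected. A 3-polytope is simple if each vertex lies in exactly 3 facets. *)

(* Defs.v *)
From mathcomp Require Import all_boot all_order all_algebra.
From mathcomp Require Import all_classical all_reals.

Set Implicit Arguments.
Unset Strict Implicit.
Unset Printing Implicit Defensive.

Import Order.TTheory GRing.Theory Num.Theory.

Local Open Scope classical_set_scope.
Local Open Scope card_scope.
Local Open Scope ring_scope.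

Section Polytopes.
Variables (R : realType) (n : nat).
Implicit Types (P F : set 'rV[R]_n) (u v x y : 'rV[R]_n) (s : seq 'rV[R]_n).

Definition conv_hull s : set 'rV[R]_n :=
  [set x | exists a : 'I_(size s) -> R,
     [/\ forall i, 0 <= a i, \sum_i a i = 1 & x = \sum_i a i *: s`_i]].

Definition segment u v : set 'rV[R]_n := conv_hull [:: u; v].

Definition polytope P : Prop := exists s, P = conv_hull s.

(* [P] contains [k.+1] affinely independent points, namely [x] and the
   [x + row i B], whose affine span contains [P]; false for the empty set. *)
Definition has_dim P (k : nat) : Prop :=
  exists x (B : 'M[R]_(k, n)),
    [/\ row_free B, P x, forall i, P (x + row i B)
      & forall y, P y -> (y - x <= B)%MS].

(* Taking [c = 0] shows that [P] itself and the empty set are faces. *)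
Definition face P F : Prop :=
  exists (c : 'cV[R]_n) (b : R),
    (forall x, P x -> (x *m c) 0 0 <= b) /\
    F = P `&` [set x | (x *m c) 0 0 = b].

Definition kface P (k : nat) F : Prop := face P F /\ has_dim F k.

Definition vertex P v : Prop := kface P 0 [set v].

Definition facet P F : Prop := exists k, has_dim P k.+1 /\ kface P k F.

Definition simple_3polytope P : Prop :=
  forall v, vertex P v -> [set F | facet P F /\ F v] #= `I_3.

(* Adjacency in the skeleton; [u != v] since the segment has dimension 1. *)
Definition skel_adj P u v : Prop :=
  [/\ vertex P u, vertex P v & kface P 1 (segment u v)].

(* A path or a cycle is given by the sequence of its vertices; as a subgraph
   of the skeleton, it has the following edges, up to orientation. *)
Definition path_edges s := zip s (behead s).
Definition cycle_edges s := zip s (rot 1 s).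

Definition skel_path P s : Prop :=
  [/\ s != [::], uniq s, forall v, v \in s -> vertex P v
    & forall u v, (u, v) \in path_edges s -> skel_adj P u v].

Definition skel_cycle P s : Prop :=
  [/\ (2 < size s)%N, uniq s, forall v, v \in s -> vertex P v
    & forall u v, (u, v) \in cycle_edges s -> skel_adj P u v].

Definition edge_within F (E : seq ('rV[R]_n * 'rV[R]_n)) : rel 'rV[R]_n :=
  fun u v => `[< ((u, v) \in E \/ (v, u) \in E) /\ segment u v `<=` F >].

(* The intersection of [F] with the graph of vertices [s] and edges [E] is the
   subgraph of the vertices and edges contained in [F]. An edge of the skeleton
   meeting a face without being contained in it meets it in one endpoint only,
   so this is also the intersection as point sets. *)
Definition inter_nonempty_connected F s E : Prop :=
  (exists2 v, v \in s & F v) /\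
  (forall u v, u \in s -> v \in s -> F u -> F v ->
     exists2 p, path (edge_within F E) u p & last u p = v).

Definition facet_hamiltonian_cycle P s : Prop :=
  skel_cycle P s /\
  forall F, facet P F -> inter_nonempty_connected F s (cycle_edges s).

Definition facet_hamiltonian_path P s : Prop :=
  skel_path P s /\
  forall F, facet P F -> inter_nonempty_connected F s (path_edges s).

End Polytopes.

(* Main.v *)
(* (i) In a simple polytope a facet containing a vertex [v] of the cycle
   contains one of the two edges of the cycle at [v], some facet contains both, and no
   two facets share both. If a facet contains the whole cycle, every other one
   meets it in a single edge, and deleting one vertex gives a path. Otherwise
   some facet [F0] contains [v_0], [v_1], [v_2] but not the vertex [v_{-1}]
   before them, and [v_0], [v_1] are deleted: no facet loses all its vertices,
   and none is cut in two, since a facet containing [v_{-1}], ..., [v_2] shares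
   two consecutive edges with [F0].
   (ii) In the triakis octahedron (an octahedron with a flat pyramid over each
   of its faces) an equator of the octahedron is a facet-Hamiltonian cycle. That
   there is no facet-Hamiltonian path is checked by an exhaustive search, which
   abandons a path as soon as it returns to a facet that it has left. *)

Require Import Defs.
From mathcomp Require Import all_boot all_order all_algebra.
From mathcomp Require Import all_classical all_reals.
From mathcomp Require Import ring lra zify.
Import Order.TTheory GRing.Theory Num.Theory.

Local Open Scope classical_set_scope.
Local Open Scope ring_scope.

Set Implicit Arguments.
Unset Strict Implicit.
Unset Printing Implicit Defensive.

(** * Functionals, faces and dimension *)

Section Functionals.
Variables (R : realType) (n : nat).
Implicit Types (c : 'cV[R]_n) (x y u v : 'rV[R]_n) (s : seq 'rV[R]_n).
Implicit Types (P F G : set 'rV[R]_n).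

Definition dot c x : R := (x *m c) 0 0.

Lemma dotE c x : dot c x = \sum_j x 0 j * c j 0.
Proof. by rewrite /dot mxE. Qed.

Lemma dotD c x y : dot c (x + y) = dot c x + dot c y.
Proof. by rewrite /dot mulmxDl mxE. Qed.

Lemma dotB c x y : dot c (x - y) = dot c x - dot c y.
Proof. by rewrite /dot mulmxBl mxE [in X in _ + X]mxE. Qed.

Lemma dotZ c a x : dot c (a *: x) = a * dot c x.
Proof. by rewrite /dot -scalemxAl mxE. Qed.

Lemma dot0 c : dot c 0 = 0.
Proof. by rewrite /dot mul0mx mxE. Qed.

Lemma dot_sum c (I : finType) (f : I -> 'rV[R]_n) :
  dot c (\sum_i f i) = \sum_i dot c (f i).
Proof. by rewrite /dot mulmx_suml summxE. Qed.

Lemma dotDl c c' x : dot (c + c') x = dot c x + dot c' x.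
Proof. by rewrite /dot mulmxDr mxE. Qed.

Lemma dotZl c a x : dot (a *: c) x = a * dot c x.
Proof. by rewrite /dot -scalemxAr mxE. Qed.

Lemma dot_eq0 c x : x *m c = 0 <-> dot c x = 0.
Proof.
split=> [h|h]; first by rewrite /dot h mxE.
by apply/matrixP=> i j; rewrite !ord1 [RHS]mxE.
Qed.

Lemma dot_sub0 c m (B : 'M[R]_(m, n)) y :
  (forall i, dot c (row i B) = 0) -> (y <= B)%MS -> dot c y = 0.
Proof.
move=> h /submxP[w ->]; rewrite -dot_eq0 -mulmxA.
suff -> : B *m c = 0 by rewrite mulmx0.
by apply/row_matrixP => i; rewrite row_mul row0 dot_eq0.
Qed.

(** * Convex hulls, supporting functionals and segments *)

Lemma mem_hull s p : p \in s -> conv_hull s p.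
Proof.
move=> ps; have ip : (index p s < size s)%N by rewrite index_mem.
exists (fun i => (i == Ordinal ip)%:R); split.
- by move=> i; case: eqP.
- rewrite (bigD1 (Ordinal ip)) //= eqxx big1 ?addr0 // => i.
  by move=> /negbTE ->.
- rewrite (bigD1 (Ordinal ip)) //= eqxx big1 ?addr0.
    by rewrite scale1r nth_index.
  by move=> i /negbTE ->; rewrite scale0r.
Qed.

Lemma hull_le s c b x :
  {in s, forall p, dot c p <= b} -> conv_hull s x -> dot c x <= b.
Proof.
move=> h [a [a0 a1 ->]]; rewrite dot_sum -[b]mul1r -a1 mulr_suml.
by apply: ler_sum => i _; rewrite dotZ ler_wpM2l // h // mem_nth.
Qed.

(** The slacks [b - dot c s_i] are nonnegative and their weighted sum vanishes, so only generators
    on the hyperplane carry weight. With [c = 0] and [b = 0] it speaks of the whole hull. *)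
Lemma hull_eq_sub s c b m (D : 'M[R]_(m, n)) p y :
  {in s, forall q, dot c q <= b} ->
  {in s, forall q, dot c q = b -> (q - p <= D)%MS} ->
  conv_hull s y -> dot c y = b -> (y - p <= D)%MS.
Proof.
move=> hb hD [a [a0 a1 ey]] yb.
have /psumr_eq0P z0 : \sum_i a i * (b - dot c s`_i) = 0.
  under eq_bigr do rewrite mulrBr.
  rewrite sumrB -mulr_suml a1 mul1r -yb ey dot_sum; apply/eqP.
  by rewrite subr_eq0; apply/eqP/eq_bigr => i _; rewrite dotZ.
have -> : y - p = \sum_i a i *: (s`_i - p).
  under eq_bigr do rewrite scalerBr.
  by rewrite sumrB -scaler_suml a1 scale1r -ey.
apply: summx_sub => i _; have := z0 _ i isT.
move=> /(_ _)/eqP; rewrite mulf_eq0 => /(_ _)/orP[|/eqP->|].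
- by move=> j _; rewrite mulr_ge0 // subr_ge0 hb // mem_nth.
- by rewrite scale0r sub0mx.
- move=> e; apply: scalemx_sub; apply: hD; first by rewrite mem_nth.
  by apply/esym/eqP; rewrite -subr_eq0.
Qed.

(** Some weight is positive, so if every generator were strictly below level [b], their convex
    combinations would be too. *)
Lemma hull_eq_exists s c b y :
  {in s, forall q, dot c q <= b} -> conv_hull s y -> dot c y = b ->
  exists2 q, q \in s & dot c q = b.
Proof.
move=> hb hy yb; apply: contrapT => no.
have hlt q : q \in s -> dot c q < b.
  by move=> qs; rewrite lt_neqAle hb // andbT; apply/eqP => e; apply: no; exists q.
case: hy => a [a0 a1 ey].
have : \sum_i a i * dot c s`_i < \sum_i a i * b.
  have /existsP[i /eqP ai] : [exists i, a i != 0].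
    apply: contrapT => /negP; rewrite negb_exists => /forallP al.
    by have := a1; rewrite big1 => [|i _]; [lra|apply/eqP; have := al i; rewrite negbK].
  rewrite (bigD1 i) //= [ltRHS](bigD1 i) //=; apply: ltr_leD.
    by rewrite ltr_pM2l ?hlt ?mem_nth // lt_def a0 andbT; apply/eqP.
  by apply: ler_sum => j _; rewrite ler_wpM2l // hb // mem_nth.
rewrite -mulr_suml a1 mul1r -yb ey dot_sum.
by under [X in _ < X]eq_bigr do rewrite dotZ; rewrite ltxx.
Qed.

Lemma segmentP u v x :
  segment u v x <-> exists2 t : R, 0 <= t <= 1 & x = u + t *: (v - u).
Proof.
split=> [[a [a0 a1 ->]]|[t /andP[t0 t1] ->]].
  exists (a (lift ord0 ord0)); move: a1; rewrite !big_ord_recl !big_ord0 /= => a1.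
    by rewrite a0 /=; have := a0 ord0; lra.
  have -> : a ord0 = 1 - a (lift ord0 ord0) by lra.
  rewrite addr0 scalerBl scale1r scalerBr -!addrA; congr (_ + _).
  by rewrite addrC.
exists (fun i : 'I_2 => if i == ord0 then 1 - t else t); split.
- by move=> i; case: ifP => _; lra.
- by rewrite !big_ord_recl !big_ord0 /=; lra.
- rewrite !big_ord_recl !big_ord0 /= addr0 scalerBl scale1r scalerBr -!addrA.
  by congr (_ + _); rewrite addrC.
Qed.

Lemma segment_l u v : segment u v u.
Proof. by apply: mem_hull; rewrite !inE eqxx. Qed.

Lemma segment_r u v : segment u v v.
Proof. by apply: mem_hull; rewrite !inE eqxx orbT. Qed.

Lemma hull_convex s u v :
  conv_hull s u -> conv_hull s v -> segment u v `<=` conv_hull s.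
Proof.
move=> [a [a0 a1 ->]] [b [b0 b1 ->]] x /segmentP[t /andP[t0 t1] ->].
exists (fun i => (1 - t) * a i + t * b i); split.
- by move=> i; rewrite addr_ge0 // mulr_ge0 // subr_ge0.
- by rewrite big_split /= -!mulr_sumr a1 b1; lra.
- rewrite -sumrB scaler_sumr -big_split /=; apply: eq_bigr => i _.
  by rewrite -scalerBl scalerA -scalerDl; congr (_ *: _); ring.
Qed.

Lemma face_convex s F u v :
  face (conv_hull s) F -> F u -> F v -> segment u v `<=` F.
Proof.
move=> [c [b [_ ->]]] [Pu /= ub] [Pv /= vb] x xs.
split=> [|/=]; first exact: hull_convex xs.
have /segmentP[t _ ->] := xs.
by move: ub vb; rewrite -/(dot c _) -!/(dot c _) dotD dotZ dotB => -> ->; ring.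
Qed.

(** Bounds dimension from above: each row of the witnessing basis is a difference of two vectors
    [y - p], hence lies in [D]. *)
Lemma has_dim_rank P k m (D : 'M[R]_(m, n)) p :
  has_dim P k -> (forall y, P y -> (y - p <= D)%MS) -> (k <= \rank D)%N.
Proof.
move=> [x [B [/eqP rB Px PB _]]] h; rewrite -[leqLHS]rB.
apply: mxrankS; apply/row_subP => i.
have -> : row i B = (x + row i B - p) - (x - p).
  by rewrite opprB addrA subrK addrAC subrr add0r.
by rewrite addmx_sub ?eqmx_opp ?h.
Qed.

Lemma has_dim_uniq P k l : has_dim P k -> has_dim P l -> k = l.
Proof.
move=> hk hl; apply/eqP; rewrite eqn_leq; apply/andP; split.
  by have [x [B [/eqP rB _ _ hB]]] := hl; rewrite -rB; apply: has_dim_rank hk hB.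
by have [x [B [/eqP rB _ _ hB]]] := hk; rewrite -rB; apply: has_dim_rank hl hB.
Qed.

Lemma has_dim_set1 v : has_dim [set v] 0.
Proof.
exists v, 0; split=> //.
- by rewrite /row_free mxrank0.
- by case.
- by move=> y ->; rewrite subrr sub0mx.
Qed.

(** By rank, [B] spans all directions of [F]; the functional exposing [G] vanishes on the rows of
    [B], hence is constant on [F]. *)
Lemma face_sub P F G k x (B : 'M[R]_(k, n)) :
  has_dim F k -> F `<=` P -> face P G -> row_free B ->
  F x -> (forall i, F (x + row i B)) -> G x -> (forall i, G (x + row i B)) ->
  F `<=` G.
Proof.
move=> [x0 [B0 [fB0 F0 FB0 hB0]]] FP [c [b [_ ->]]] fB Fx FB [_ /= Gx] GB y Fy.
split=> [|/=]; first exact: FP.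
have BB0 : (B <= B0)%MS.
  apply/row_subP => i.
  have -> : row i B = (x + row i B - x0) - (x - x0).
    by rewrite opprB addrA subrK addrAC subrr add0r.
  by rewrite addmx_sub ?eqmx_opp ?hB0.
have B0B : (B0 <= B)%MS.
  by have [_ <-] := mxrank_leqif_sup BB0; rewrite (eqP fB) (eqP fB0).
have yB : (y - x <= B)%MS.
  have -> : y - x = (y - x0) - (x - x0) by rewrite opprB addrA subrK.
  by apply: submx_trans B0B; rewrite addmx_sub ?eqmx_opp ?hB0.
apply/eqP; rewrite -Gx -subr_eq0 -!/(dot c _) -dotB; apply/eqP.
apply: dot_sub0 yB => i; have [_ /=] := GB i.
by rewrite -Gx -!/(dot c _) dotD; lra.
Qed.

Lemma face_subset P F : face P F -> F `<=` P.
Proof. by move=> [c [b [_ ->]]] x []. Qed.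

Lemma kface_inj P F G k x (B : 'M[R]_(k, n)) :
  kface P k F -> kface P k G -> row_free B ->
  F x -> (forall i, F (x + row i B)) -> G x -> (forall i, G (x + row i B)) ->
  F = G.
Proof.
move=> [fF dF] [fG dG] fB Fx FB Gx GB; apply/seteqP; split.
  exact: (face_sub dF (face_subset fF) fG fB Fx FB Gx GB).
exact: (face_sub dG (face_subset fG) fF fB Gx GB Fx FB).
Qed.

(** Applying [c] to a linear relation kills the [d] term, hence the coefficient of [e]; then
    [d != 0] kills the other one. *)
Lemma row_free2 c (d e : 'rV[R]_n) :
  dot c d = 0 -> d != 0 -> dot c e != 0 -> row_free (col_mx d e).
Proof.
move=> cd d0 ce; rewrite -kermx_eq0; apply/eqP/row_matrixP => i.
rewrite row0; set w := row i _.
have : w *m col_mx d e = 0 by apply/sub_kermxP; exact: row_sub.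
rewrite -[w]hsubmxK mul_row_col; set a := lsubmx w; set b := rsubmx w => h.
have b0 : b = 0.
  have := congr1 (dot c) h; rewrite dotD dot0.
  rewrite (mx11_scalar a) (mx11_scalar b) !mul_scalar_mx !dotZ cd mulr0 add0r.
  by move=> /eqP; rewrite mulf_eq0 (negbTE ce) orbF => /eqP ->; rewrite raddf0.
move: h; rewrite b0 mul0mx addr0 (mx11_scalar a) mul_scalar_mx => /eqP.
rewrite scaler_eq0 (negbTE d0) orbF => /eqP ->; rewrite raddf0.
exact: row_mx0.
Qed.

(** A functional exposing [v] also attains its maximum over [s] at a generator. The list [s] need
    not generate [P]: taking two points shows that a vertex on a segment is one of its ends. *)
Lemma vertex_in_hull P s v :
  vertex P v -> {in s, forall q, P q} -> conv_hull s v -> v \in s.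
Proof.
move=> [[c [b [hb e]]] _] sP hv.
have [_ vb] : (P `&` [set x | (x *m c) 0 0 = b]) v by rewrite -e.
have [q qs qb] := @hull_eq_exists s c b v (fun q qs => hb q (sP q qs)) hv vb.
by have <- : q = v; [have : [set v] q by rewrite e; split; [exact: sP|] |].
Qed.

Lemma segment_vertex s u v w :
  conv_hull s u -> conv_hull s v -> vertex (conv_hull s) w -> segment u v w ->
  w = u \/ w = v.
Proof.
move=> hu hv hw huv.
have : w \in [:: u; v].
  by apply: (vertex_in_hull hw) => // q; rewrite !inE => /orP[]/eqP->.
by rewrite !inE => /orP[]/eqP->; [left|right].
Qed.

Lemma skel_adj_neq P u v : skel_adj P u v -> u != v.
Proof.
move=> [_ _ [_ h]]; apply/eqP => e; subst v.
have : (1 <= \rank (0 : 'M[R]_n)%R)%N.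
  apply: (has_dim_rank (p := u)) h _ => y /segmentP[t _ ->].
  by rewrite subrr scaler0 addr0 subrr sub0mx.
by rewrite mxrank0.
Qed.

Lemma vertex_mem P v : vertex P v -> P v.
Proof. by move=> [f _]; exact: (face_subset f). Qed.

Lemma edge_support P u v : skel_adj P u v ->
  exists (c : 'cV[R]_n) (b : R), [/\ forall x, P x -> dot c x <= b,
    dot c u = b, dot c v = b & forall x, P x -> dot c x = b -> segment u v x].
Proof.
move=> [_ _ [[c [b [hb e]]] _]]; exists c, b; split=> //.
- by have : segment u v u := segment_l u v; rewrite e => -[].
- by have : segment u v v := segment_r u v; rewrite e => -[].
- by move=> x Px xb; rewrite e; split.
Qed.

(* The third point is off the line [a v], witnessed by the functional exposing
   the edge [v b]. *)
Lemma skel_path2_free s a v b :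
  skel_adj (conv_hull s) a v -> skel_adj (conv_hull s) v b -> a != b ->
  row_free (col_mx (b - v) (a - v)).
Proof.
move=> hav hvb ab; have [c [d [cd cv cb hc]]] := edge_support hvb.
have [hv hb _] := hvb; have [ha _ _] := hav.
apply: (@row_free2 c).
- by rewrite dotB cv cb subrr.
- by rewrite subr_eq0 eq_sym (skel_adj_neq hvb).
- rewrite dotB cv subr_eq0; apply/eqP => ad.
  have := hc a (vertex_mem ha) ad.
  move=> /(segment_vertex (vertex_mem hv) (vertex_mem hb) ha)[] e.
    by move: (skel_adj_neq hav); rewrite e eqxx.
  by rewrite e eqxx in ab.
Qed.

Lemma forall_ord2_col (Q : 'rV[R]_n -> Prop) (d e : 'rV[R]_n) :
  Q d -> Q e -> forall i, Q (row i (col_mx d e)).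
Proof.
move=> Qd Qe i; case: (split_ordP i) => j ->.
  by rewrite rowKu ord1 row_id.
by rewrite rowKd ord1 row_id.
Qed.

(** Two consecutive edges give three affinely independent points, which determine a 2-face. *)
Lemma kface2_inj s a v b F G :
  skel_adj (conv_hull s) a v -> skel_adj (conv_hull s) v b -> a != b ->
  kface (conv_hull s) 2 F -> kface (conv_hull s) 2 G ->
  F a -> F v -> F b -> G a -> G v -> G b -> F = G.
Proof.
move=> hav hvb ab hF hG Fa Fv Fb Ga Gv Gb.
apply: (kface_inj (x := v) hF hG (skel_path2_free hav hvb ab)) => //.
  by apply: (forall_ord2_col (Q := fun r => F (v + r))); rewrite addrC subrK.
by apply: (forall_ord2_col (Q := fun r => G (v + r))); rewrite addrC subrK.
Qed.

(** The generators are chosen greedily, each outside the affine span of the previous ones, which is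
    too small to contain [F]. *)
Lemma face2_three_points s F :
  kface (conv_hull s) 2 F -> exists u v w,
    [/\ u \in s, v \in s & w \in s] /\ [/\ F u, F v & F w] /\
    [/\ u != v, u != w & v != w].
Proof.
move=> [[c [b [hb eF]]] dF]; apply: contrapT => no.
have hbs : {in s, forall q, dot c q <= b} by move=> q /mem_hull/hb.
have memF q : q \in s -> dot c q = b -> F q.
  by move=> qs qb; rewrite eF; split=> //; exact: mem_hull.
have small m (D : 'M[R]_(m, n)) p : (\rank D < 2)%N ->
    exists q, [/\ q \in s, F q & ~ (q - p <= D)%MS].
  move=> rD; apply: contrapT => no2; have : (2 <= \rank D)%N.
    apply: (has_dim_rank (p := p)) dF _ => y; rewrite eF => -[hy yb].
    apply: hull_eq_sub hbs _ hy yb => q qs qb; apply: contrapT => nq.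
    by apply: no2; exists q; split=> //; exact: memF.
  by rewrite leqNgt rD.
(* The base point [0] is arbitrary here: only a generator in [F] is wanted. *)
have [|u [us Fu _]] := small n 0 0; first by rewrite mxrank0.
have [|v [vs Fv nv]] := small n 0 u; first by rewrite mxrank0.
have [|w [ws Fw nw]] := small 1%N (v - u) u; first by rewrite ltnS rank_leq_row.
apply: no; exists u, v, w; do !split=> //; apply/eqP => e.
- by apply: nv; rewrite e subrr sub0mx.
- by apply: nw; rewrite e subrr sub0mx.
- by apply: nw; rewrite e submx_refl.
Qed.

End Functionals.

(** * Facets of 3-polytopes *)

Section DimensionThree.
Variable R : realType.
Implicit Types (c g : 'cV[R]_3) (x y u v w a : 'rV[R]_3) (s : seq 'rV[R]_3).
Implicit Types (P F G : set 'rV[R]_3).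

(** In dimension 3 the kernel of a nonzero functional has rank 2, so the rows of [B] fill it. *)
Lemma ker_plane c (B : 'M[R]_(2, 3)) y :
  c != 0 -> row_free B -> (forall i, dot c (row i B) = 0) -> dot c y = 0 ->
  (y <= B)%MS.
Proof.
move=> c0 /eqP rB cB cy.
have Bk : (B <= kermx c)%MS.
  by apply/row_subP => i; apply/sub_kermxP; rewrite dot_eq0.
have rc : \rank c = 1%N by apply/eqP; rewrite eqn_leq rank_leq_col lt0n mxrank_eq0.
have kB : (kermx c <= B)%MS.
  by have [_ <-] := mxrank_leqif_sup Bk; rewrite mxrank_ker rB rc.
by apply: submx_trans kB; apply/sub_kermxP; rewrite dot_eq0.
Qed.

Lemma kface2_of_points P c b x (d e : 'rV[R]_3) :
  (forall y, P y -> dot c y <= b) -> c != 0 -> row_free (col_mx d e) ->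
  P x -> P (x + d) -> P (x + e) ->
  dot c x = b -> dot c (x + d) = b -> dot c (x + e) = b ->
  kface P 2 (P `&` [set y | dot c y = b]).
Proof.
move=> hb c0 fB Px Pd Pe xb db eb; split; first by exists c, b; split.
exists x, (col_mx d e); split=> //.
  by apply: (forall_ord2_col
    (Q := fun r => (P `&` [set y | dot c y = b]) (x + r))).
move=> y [_ /= yb]; apply: (ker_plane c0 fB).
  move: db eb; rewrite !dotD => db eb.
  by apply: (forall_ord2_col (Q := fun r => dot c r = 0)); lra.
by rewrite dotB; lra.
Qed.

(** The dimension of [P] is unique, which pins the [k] hidden in [facet] to 2. *)
Lemma facet_kface P F : has_dim P 3 -> facet P F <-> kface P 2 F.
Proof.
move=> h3; split=> [[k [hk hF]]|hF]; last by exists 2.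
by move: hF; have [<-] := has_dim_uniq h3 hk.
Qed.

Lemma seq_argmax (T : eqType) (f : T -> R) (A : seq T) :
  A != [::] -> exists2 m, m \in A & {in A, forall q, f q <= f m}.
Proof.
elim: A => // p A IH _; case: (eqVneq A [::]) => [->|/IH[m mA hm]].
  by exists p; rewrite ?inE // => q; rewrite inE => /eqP->.
have [pm|mp] := leP (f p) (f m).
  by exists m; rewrite ?inE ?mA ?orbT // => q; rewrite inE => /orP[/eqP->|/hm].
exists p; rewrite ?inE ?eqxx // => q; rewrite inE => /orP[/eqP->//|/hm].
by move=> /le_trans; apply; exact: ltW.
Qed.

(* A supporting plane of the edge [u w], rotated about it until it hits
   another point of [s], becomes the supporting plane of a facet. *)
Lemma tilt s c b g u w :
  has_dim (conv_hull s) 3 ->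
  {in s, forall q, dot c q <= b} -> dot c u = b -> dot c w = b ->
  conv_hull s u -> conv_hull s w -> u != w ->
  (forall x, conv_hull s x -> dot c x = b -> segment u w x) ->
  dot g (w - u) = 0 -> (forall t, g + t *: c != 0) ->
  exists t x, [/\ x \in s, dot c x < b,
    dot (g + t *: c) x = dot g u + t * b,
    {in s, forall y, dot (g + t *: c) y <= dot g u + t * b} &
    kface (conv_hull s) 2
      (conv_hull s `&` [set y | dot (g + t *: c) y = dot g u + t * b])].
Proof.
move=> h3 hb cu cw hu hw uw hseg gd gc.
pose A := [seq q <- s | dot c q < b].
(* Otherwise all generators lie on the segment [u w], and the hull has dimension at most 1. *)
have A0 : A != [::].
  apply/eqP => A0.
  have h q : q \in s -> (q - u <= (w - u))%MS.
    move=> qs; have : segment u w q.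
      apply: hseg; [exact: mem_hull|apply/eqP].
      have : q \notin A by rewrite A0.
      by rewrite mem_filter qs andbT -leNgt eq_le hb.
    by move=> /segmentP[t _ ->]; rewrite addrC addKr scalemx_sub.
  have : (3 <= \rank (w - u)%R)%N.
    apply: (has_dim_rank (p := u)) h3 _ => y hy.
    apply: (@hull_eq_sub _ _ s 0 0) hy _ => [q _|q qs _|].
    - by rewrite /dot mulmx0 mxE.
    - exact: h.
    - by rewrite /dot mulmx0 mxE.
  by move/leq_trans/(_ (rank_leq_row _)).
(* The maximal ratio is the least [t] for which the tilted plane still supports the hull; a
   maximizer lies on that plane. *)
have [x xA hx] := seq_argmax (fun q => (dot g q - dot g u) / (b - dot c q)) A0.
set t := (_ / _) in hx.
move: (xA); rewrite mem_filter => /andP[cx xs].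
have ht : {in s, forall y, dot (g + t *: c) y <= dot g u + t * b}.
  move=> y ys; rewrite dotDl dotZl.
  have [cy|cy] := ltP (dot c y) b.
    have := hx y; rewrite mem_filter cy ys => /(_ isT).
    by rewrite ler_pdivrMr ?subr_gt0 //; lra.
  have /(hseg _ (mem_hull ys))/segmentP[r _ ->] : dot c y = b.
    by apply/eqP; rewrite eq_le cy hb.
  by rewrite !dotD !dotZ gd dotB cu cw; lra.
have tx : dot (g + t *: c) x = dot g u + t * b.
  rewrite dotDl dotZl /t; set f := dot c x in cx *.
  have : b - f != 0 by rewrite subr_eq0 gt_eqF.
  by move=> ?; field.
have du : dot g w = dot g u by move: gd; rewrite dotB => /eqP; rewrite subr_eq0 => /eqP.
exists t, x; split=> //.
have free : row_free (col_mx (w - u) (x - u)).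
  apply: (@row_free2 _ _ c).
  - by rewrite dotB cu cw subrr.
  - by rewrite subr_eq0 eq_sym.
  - by rewrite dotB cu subr_eq0 lt_eqF.
have ew : u + (w - u) = w by rewrite addrC subrK.
have ex : u + (x - u) = x by rewrite addrC subrK.
apply: (kface2_of_points (x := u) _ (gc t) free); rewrite ?ew ?ex //.
- by move=> y; exact: hull_le.
- exact: mem_hull.
- by rewrite dotDl dotZl cu.
- by rewrite dotDl dotZl cw du.
Qed.

(** The supporting plane of the edge is tilted in the two opposite directions [g] and [- g]. *)
Lemma edge_two_facets s u w : has_dim (conv_hull s) 3 ->
  skel_adj (conv_hull s) u w ->
  exists F G, [/\ facet (conv_hull s) F, facet (conv_hull s) G, F <> G,
    F u /\ F w & G u /\ G w].
Proof.
move=> h3 huw; have uw := skel_adj_neq huw.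
have [c [b [hb cu cw hseg]]] := edge_support huw.
have [/vertex_mem hu /vertex_mem hw _] := huw.
have hbs : {in s, forall q, dot c q <= b} by move=> q /mem_hull/hb.
(* The functionals vanishing on [w - u] form a space of rank at least 2, so they are not all
   multiples of [c]. *)
have [g gd gc] : exists2 g : 'cV[R]_3, dot g (w - u) = 0
    & ~ exists t, g = t *: c.
  apply: contrapT => no.
  have : ((cokermx (w - u))^T <= c^T)%MS.
    apply/row_subP => i; apply: contrapT => ni; apply: no.
    exists (row i (cokermx (w - u))^T)^T.
      by rewrite -dot_eq0 -tr_col trmxK colE mulmxA mulmx_coker mul0mx.
    move=> [t e]; apply: ni.
    by rewrite -[row i _]trmxK e linearZ /= scalemx_sub.
  move=> /mxrankS; rewrite !mxrank_tr mxrank_coker => h.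
  have := leq_trans h (rank_leq_col _).
  by have := rank_leq_row (w - u); case: (\rank (w - u)) => [|[|]].
have gc1 t : g + t *: c != 0.
  apply/eqP => /eqP; rewrite addr_eq0 => /eqP e; apply: gc.
  by exists (- t); rewrite scaleNr.
have gc2 t : - g + t *: c != 0.
  by apply/eqP => /eqP; rewrite addrC subr_eq0 => /eqP e; apply: gc; exists t.
have gN x : dot (- g) x = - dot g x by rewrite -scaleN1r dotZl mulN1r.
have gdN : dot (- g) (w - u) = 0 by rewrite gN gd oppr0.
have [t [x [xs cx tx ht hF]]] := tilt h3 hbs cu cw hu hw uw hseg gd gc1.
have [t' [x' [xs' cx' tx' ht' hG]]] := tilt h3 hbs cu cw hu hw uw hseg gdN gc2.
have gw : dot g w = dot g u by move: gd; rewrite dotB => /eqP; rewrite subr_eq0 => /eqP.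
eexists; eexists; split; [exact: ex_intro _ 2%N (conj h3 hF)|
  exact: ex_intro _ 2%N (conj h3 hG)| | |].
- move=> e.
  have [_] : (conv_hull s `&` [set y | dot (- g + t' *: c) y = dot (- g) u + t' * b]) x.
    by rewrite -e; split=> //; exact: mem_hull.
  rewrite /= !dotDl !dotZl !gN => ex; move: tx; rewrite !dotDl !dotZl => tx.
  (* Adding the equations of both planes at [x], a point strictly below the plane of [c]. *)
  have tt' : t' = - t.
    have : (t + t') * (b - dot c x) = 0 by lra.
    by move=> /eqP; rewrite mulf_eq0 subr_eq0 (gt_eqF cx) orbF => /eqP; lra.
  (* The two functionals are now opposite, so both inequalities are equalities and the hull is
     flat. *)
  have : (3 <= \rank (kermx (g + t *: c)%R))%N.
    apply: (has_dim_rank (p := u)) h3 _ => y hy.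
    apply: (@hull_eq_sub _ _ s 0 0) hy _ => [q _|q qs _|].
    + by rewrite /dot mulmx0 mxE.
    + apply/sub_kermxP; rewrite dot_eq0 dotB !dotDl !dotZl cu.
      have := ht q qs; have := ht' q qs.
      by rewrite tt' !dotDl !dotZl !gN; lra.
    + by rewrite /dot mulmx0 mxE.
  rewrite mxrank_ker; have : (0 < \rank (g + t *: c)%R)%N by rewrite lt0n mxrank_eq0.
  by case: (\rank _) => [|[|[|[|]]]].
- by split; split=> //=; rewrite dotDl dotZl ?cu ?cw ?gw.
- by split; split=> //=; rewrite dotDl dotZl ?gN ?cu ?cw ?gw.
Qed.
End DimensionThree.

(** * Paths and cycles meeting a convex set *)

(* [size s] occurs at several convertible carrier types, which [lia] would take
   for distinct atoms. *)
Ltac size_lia :=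
  repeat match goal with
  | H : context [@size ?T ?s] |- _ =>
      match type of s with list ?U =>
        tryif constr_eq T U then fail else change (@size T s) with (@size U s) in H
      end
  | |- context [@size ?T ?s] =>
      match type of s with list ?U =>
        tryif constr_eq T U then fail else change (@size T s) with (@size U s)
      end
  end; lia.

Lemma nth_rot (T : Type) (x0 : T) (s : seq T) k i :
  (k <= size s)%N -> (i < size s)%N ->
  nth x0 (rot k s) i = nth x0 s ((k + i) %% size s).
Proof.
move=> ks hi; rewrite /rot nth_cat size_drop; case: ifP => h.
  by rewrite nth_drop modn_small //; lia.
rewrite nth_take; last lia.
have -> : (k + i = size s + (i - (size s - k)))%N by lia.
by rewrite modnDl modn_small //; lia.
Qed.

Section Connectivity.
Variables (R : realType) (n : nat).
Implicit Types (x y u v : 'rV[R]_n) (s p : seq 'rV[R]_n).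
Implicit Types (F : set 'rV[R]_n) (E : seq ('rV[R]_n * 'rV[R]_n)).

Local Notation "s `_ i" := (nth 0 s i).

Lemma path_edgesP s u v :
  (u, v) \in path_edges s ->
  exists i, [/\ (i.+1 < size s)%N, u = s`_i & v = s`_i.+1].
Proof.
rewrite /path_edges => /(nthP (0, 0))[i]; rewrite size_zip size_behead => hi.
rewrite nth_zip_cond size_zip size_behead hi /= nth_behead => -[<- <-].
by exists i; split=> //; move: hi; case: (size s) => [|m]; rewrite leq_min /=; size_lia.
Qed.

Lemma path_edges_nth s i : (i.+1 < size s)%N -> (s`_i, s`_i.+1) \in path_edges s.
Proof.
move=> hi; apply/(nthP (0, 0)); exists i.
  by rewrite size_zip size_behead leq_min (ltnW hi) ltn_predRL.
by rewrite nth_zip_cond size_zip size_behead nth_behead leq_min (ltnW hi) ltn_predRL hi.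
Qed.

Lemma cycle_edgesP s u v :
  (u, v) \in cycle_edges s <->
  exists i, [/\ (i < size s)%N, u = s`_i & v = s`_(i.+1 %% size s)].
Proof.
split=> [/(nthP (0, 0))[i]|[i [hi -> ->]]].
  rewrite size_zip size_rot minnn => hi.
  rewrite nth_zip ?size_rot // => -[<- <-]; exists i; split=> //.
  by rewrite nth_rot //; size_lia.
apply/(nthP (0, 0)); exists i; first by rewrite size_zip size_rot minnn.
by rewrite nth_zip ?size_rot // nth_rot //; size_lia.
Qed.

Lemma cycle_edges_rot s k : cycle_edges (rot k s) =i cycle_edges s.
Proof.
have rot_zip (T : Type) (a b : seq T) : size a = size b ->
    zip (rot k a) (rot k b) = rot k (zip a b).
  move=> ab; rewrite -{2}(cat_take_drop k a) -{2}(cat_take_drop k b).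
  have tt : size (take k a) = size (take k b) by rewrite !size_take ab.
  rewrite zip_cat // /rot zip_cat; last by rewrite !size_drop ab.
  have [ka|ak] := leqP k (size a).
    have e : size (zip (take k a) (take k b)) = k.
      by rewrite size_zip -tt minnn size_takel.
    by rewrite drop_size_cat // take_size_cat.
  rewrite (take_oversize (ltnW ak)) (drop_oversize (ltnW ak)).
  rewrite ab in ak; rewrite (take_oversize (ltnW ak)) (drop_oversize (ltnW ak)).
  by rewrite /= cats0 drop_oversize ?take_oversize // size_zip ab minnn ltnW.
move=> e; suff -> : cycle_edges (rot k s) = rot k (cycle_edges s) by rewrite mem_rot.
by rewrite /cycle_edges rot_rot rot_zip // size_rot.
Qed.

Lemma path_edges_drop_cycle s k :
  {subset path_edges (drop k s) <= cycle_edges s}.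
Proof.
move=> [u v] /path_edgesP[i []]; rewrite size_drop !nth_drop => hi -> ->.
apply/cycle_edgesP; exists (k + i)%N; rewrite -addnS modn_small; last size_lia.
by split=> //; size_lia.
Qed.

Lemma path_invariant (T : Type) (e : rel T) (I : T -> Prop) (x : T) (q : seq T) :
  (forall a b, I a -> e a b -> I b) -> I x -> path e x q -> I (last x q).
Proof.
by move=> h; elim: q x => //= y q IH x Ix /andP[/(h _ _ Ix)]; exact: IH.
Qed.

Lemma edge_within_mem F E u v :
  edge_within F E u v -> [/\ F u, F v & (u, v) \in E \/ (v, u) \in E].
Proof.
by move=> /asboolP[h sF]; split=> //; apply: sF; [exact: segment_l|exact: segment_r].
Qed.

Lemma nth_uniq_inj s i j : uniq s -> (i < size s)%N -> (j < size s)%N ->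
  s`_i = s`_j -> i = j.
Proof. by move=> us hi hj /eqP; rewrite nth_uniq // => /eqP. Qed.

(** The connectivity half of [inter_nonempty_connected]. *)
Definition joined F s E := forall u v, u \in s -> v \in s -> F u -> F v ->
  exists2 p, path (edge_within F E) u p & last u p = v.

(** A walk inside [F] starting before a missing vertex [k] never gets past it: its index stays below
    [k]. *)
Lemma cut_path F s i k j :
  uniq s -> joined F s (path_edges s) -> (i < k < j)%N -> (j < size s)%N ->
  F s`_i -> F s`_j -> F s`_k.
Proof.
move=> us js /andP[ik kj] hj Fi Fj; apply: contrapT => nk.
have [||q hq] := js s`_i s`_j _ _ Fi Fj; try by apply: mem_nth; size_lia.
have : exists2 m, (m < k)%N & last s`_i q = s`_m.
  apply: (path_invariant (I := fun x => exists2 m, (m < k)%N & x = s`_m)) hq.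
    move=> a b [m mk ->] /edge_within_mem[_ Fb [] /path_edgesP[l [hl]]].
      move=> /(nth_uniq_inj us) el eb. exists l.+1 => //.
      have {}el : m = l by apply: el; size_lia.
      have [] := leqP k l.+1 => // kl; case: nk.
      have <- : l.+1 = k by size_lia.
      by rewrite -eb.
    move=> eb /(nth_uniq_inj us) el; exists l => //.
    have {}el : m = l.+1 by apply: el; size_lia.
    by size_lia.
  by exists i.
move=> [m mk -> /(nth_uniq_inj us) e].
have : m = j by apply: e; size_lia.
by size_lia.
Qed.

(** If [l] were missing as well as [k], the two would separate [i] from [j] on the cycle. *)
Lemma cut_cycle F s i k j l :
  uniq s -> joined F s (cycle_edges s) -> (i < k < j)%N -> (j < size s)%N ->
  F s`_i -> F s`_j -> ~ F s`_k -> (l <= i)%N || (j <= l < size s)%N -> F s`_l.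
Proof.
move=> us js /andP[ik kj] hj Fi Fj nk hl; apply: contrapT => nl.
(* A walk inside [F] cannot leave the arc between two missing vertices. *)
have trap m m' a b : (a < m < b)%N -> (b < size s)%N -> ~ F s`_a -> ~ F s`_b ->
    (m' < size s)%N -> F s`_m -> F s`_m' -> (a < m' < b)%N.
  move=> /andP[am mb] hb na nb hm' Fm Fm'.
  have [||q hq] := js s`_m s`_m' _ _ Fm Fm'; try by apply: mem_nth; size_lia.
  have : exists2 t, (a < t < b)%N & last s`_m q = s`_t.
    apply: (path_invariant (I := fun x => exists2 t, (a < t < b)%N & x = s`_t)) hq.
      move=> x y [t /andP[at_ tb] ->] /edge_within_mem[_ Fy [] /cycle_edgesP[r [hr]]].
        move=> /(nth_uniq_inj us) er.
        have {}er : t = r by apply: er; size_lia.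
        rewrite modn_small; last size_lia.
        move=> ey; exists r.+1 => //.
        have : r.+1 <> b by move=> e; apply: nb; rewrite -e -ey.
        size_lia.
      move=> ey /(nth_uniq_inj us) et.
      have {}et : t = (r.+1 %% size s)%N.
        by apply: et; [size_lia|rewrite ltn_mod; size_lia].
      (* The closing edge would give [t = 0], contrary to [a < t]. *)
      have rs : (r.+1 < size s)%N.
        rewrite ltn_neqAle hr andbT; apply/eqP => e.
        by move: et; rewrite e modnn; size_lia.
      move: et; rewrite modn_small // => et; exists r => //.
      have : r <> a by move=> e; apply: na; rewrite -e -ey.
      size_lia.
    by exists m => //; size_lia.
  move=> [t tab -> /(nth_uniq_inj us) e].
  have <- : t = m' by apply: e; size_lia.
  by [].
have li : l <> i by move=> e; apply: nl; rewrite e.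
have lj : l <> j by move=> e; apply: nl; rewrite e.
have [lti|ltj] : (l < i)%N \/ (j < l < size s)%N by size_lia.
  have : (l < j < k)%N by apply: (trap i) => //; size_lia.
  by lia.
have : (k < i < l)%N by apply: (trap j) => //; size_lia.
by lia.
Qed.

(** Converse of [cut_path]: convexity puts every edge between consecutive vertices of [F] inside
    [F]. *)
Lemma interval_joined F p :
  (forall u v, F u -> F v -> segment u v `<=` F) ->
  (forall i k j, (i < k < j)%N -> (j < size p)%N -> F p`_i -> F p`_j -> F p`_k) ->
  joined F p (path_edges p).
Proof.
move=> cF int; pose e := edge_within F (path_edges p).
have step i : (i.+1 < size p)%N -> F p`_i -> F p`_i.+1 ->
    e p`_i p`_i.+1 /\ e p`_i.+1 p`_i.
  move=> hi Fi Fi1; have h := path_edges_nth hi.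
  split; apply/asboolP; split; try exact: cF; [by left|by right].
(* Induction on the index distance, building the walks in both directions at once. *)
have walk d i : (i + d < size p)%N -> F p`_i -> F p`_(i + d) ->
    (exists2 q, path e p`_i q & last p`_i q = p`_(i + d)) /\
    (exists2 q, path e p`_(i + d) q & last p`_(i + d) q = p`_i).
  elim: d i => [|d IH] i hd Fi Fd; first by rewrite addn0; split; exists [::].
  have Fi1 : F p`_i.+1.
    case: d {IH} hd Fd => [|d] hd Fd; first by move: Fd; rewrite addn1.
    by apply: (int i i.+1 (i + d.+2)%N) => //; size_lia.
  have hi : (i.+1 < size p)%N by size_lia.
  have [e1 e2] := step i hi Fi Fi1.
  have := IH i.+1; rewrite addSnnS => /(_ hd Fi1 Fd)[[q hq lq] [r hr lr]].
  split; first by exists (p`_i.+1 :: q) => //=; rewrite e1.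
  by exists (rcons r p`_i); rewrite ?rcons_path ?lr ?hr //= last_rcons.
move=> u v /(nthP 0)[i hi <-] /(nthP 0)[j hj <-] Fi Fj.
have [ij|/ltnW ji] := leqP i j.
  by have := walk (j - i)%N i; rewrite subnKC // => /(_ hj Fi Fj)[].
by have := walk (i - j)%N j; rewrite subnKC // => /(_ hi Fj Fi)[].
Qed.

(** The vertices deleted are those before [s_m]. If the rest of the trace of [F] has a hole, then by
    [cut_cycle] the trace goes round the other way, through the last vertex and [s_0], ...,
    [s_m]. *)
Lemma joined_drop_cycle F s m :
  (forall u v, F u -> F v -> segment u v `<=` F) ->
  uniq s -> joined F s (cycle_edges s) -> (m < size s)%N ->
  (forall i, (i < size s)%N -> F s`_i) \/
    ~ (F s`_(size s).-1 /\ forall i, (i <= m)%N -> F s`_i) ->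
  joined F (drop m s) (path_edges (drop m s)).
Proof.
move=> cF us js ms hF; apply: interval_joined => // i k j ikj.
rewrite size_drop !nth_drop => hj Fi Fj; case: hF => [h|h]; first by apply: h; size_lia.
apply: contrapT => nk; apply: h.
have cut l : (l <= m + i)%N || (m + j <= l < size s)%N -> F s`_l.
  by apply: (cut_cycle us js _ _ Fi Fj nk); size_lia.
by split=> [|l hl]; apply: cut; size_lia.
Qed.

End Connectivity.

(** * Simple polytopes *)

Section SimplePolytopes.
Variable R : realType.
Implicit Types (a b u v : 'rV[R]_3) (g s p : seq 'rV[R]_3) (F G : set 'rV[R]_3).

Local Notation "s `_ i" := (nth 0 s i).

Lemma simple_pigeonhole (P : set 'rV[R]_3) v (A B C D : set 'rV[R]_3) :
  simple_3polytope P -> vertex P v ->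
  facet P A /\ A v -> facet P B /\ B v -> facet P C /\ C v -> facet P D /\ D v ->
  [\/ A = B, A = C, A = D | [\/ B = C, B = D | C = D]].
Proof.
move=> hP hv hA hB hC hD; have /card_set_bijP[f [fI finj _]] := hP v hv.
have eqf X Y : facet P X /\ X v -> facet P Y /\ Y v -> f X = f Y -> X = Y.
  by move=> hX hY; apply: finj; rewrite inE.
have := fI _ hA; have := fI _ hB; have := fI _ hC; have := fI _ hD.
rewrite /= => fD fC fB fA.
have : f A = f B \/ f A = f C \/ f A = f D \/ f B = f C \/ f B = f D \/ f C = f D.
  by lia.
case=> [/eqf|[/eqf|[/eqf|[/eqf|[/eqf|/eqf]]]]] h.
- by apply: Or41; exact: h.
- by apply: Or42; exact: h.
- by apply: Or43; exact: h.
- by apply/Or44/Or31; exact: h.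
- by apply/Or44/Or32; exact: h.
- by apply/Or44/Or33; exact: h.
Qed.

(** * The three facets at a vertex [v] and two edges [a v], [v b] of a simple polytope *)

Section TwoEdges.
Variables (g : seq 'rV[R]_3) (a v b : 'rV[R]_3).
Let P := conv_hull g.
Hypotheses (P3 : has_dim P 3) (simpleP : simple_3polytope P).
Hypotheses (av : skel_adj P a v) (vb : skel_adj P v b) (ab : a != b).

Let vertex_v : vertex P v. Proof. by case: av. Qed.

Lemma two_edges_facet_inj F G : facet P F -> facet P G ->
  F a -> F v -> F b -> G a -> G v -> G b -> F = G.
Proof. by rewrite !facet_kface //; exact: kface2_inj. Qed.

Let facets_av : exists F G, [/\ facet P F, facet P G, F <> G,
  F a /\ F v & G a /\ G v].
Proof. exact: edge_two_facets. Qed.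

Let facets_vb : exists F G, [/\ facet P F, facet P G, F <> G,
  F v /\ F b & G v /\ G b].
Proof. exact: edge_two_facets. Qed.

(** Otherwise [F] and the two facets through [a v] are all the facets at [v]. The two facets through
    [v b] are not [F], so they contain [a] too and coincide, a contradiction. *)
Lemma two_edges_cover F : facet P F -> F v -> F a \/ F b.
Proof.
move=> hF Fv; apply: contrapT => /not_orP[na nb].
have [A [A' [hA hA' AA' [Aa Av] [A'a A'v]]]] := facets_av.
have [B [B' [hB hB' BB' [Bv Bb] [B'v B'b]]]] := facets_vb.
have notF X : X a \/ X b -> F <> X by move=> h e; subst X; tauto.
have mem X : facet P X -> X v -> X b -> X = A \/ X = A'.
  move=> hX Xv Xb.
  have [/notF|/notF|/notF|[|<-|<-]] := simple_pigeonhole simpleP vertex_v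
    (conj hF Fv) (conj hA Av) (conj hA' A'v) (conj hX Xv); by tauto.
have Ba : B a by have [->|->] := mem B hB Bv Bb.
have B'a : B' a by have [->|->] := mem B' hB' B'v B'b.
by apply: BB'; apply: two_edges_facet_inj.
Qed.

(** Each edge lies in two facets; among these four facets at [v], one through [a v] must equal one
    through [v b]. *)
Lemma two_edges_facet : exists F, [/\ facet P F, F a, F v & F b].
Proof.
have [A [A' [hA hA' AA' [Aa Av] [A'a A'v]]]] := facets_av.
have [B [B' [hB hB' BB' [Bv Bb] [B'v B'b]]]] := facets_vb.
have [//|e|e|[e|e|//]] := simple_pigeonhole simpleP vertex_v (conj hA Av)
  (conj hA' A'v) (conj hB Bv) (conj hB' B'v).
- by exists A; split=> //; rewrite e.
- by exists A; split=> //; rewrite e.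
- by exists A'; split=> //; rewrite e.
- by exists A'; split=> //; rewrite e.
Qed.

(** Two of the three facets at [v] contain [a], leaving room for one only. *)
Lemma edge_avoiding_facet_inj F G : facet P F -> facet P G ->
  F v -> G v -> ~ F a -> ~ G a -> F = G.
Proof.
move=> hF hG Fv Gv na na'.
have [A [A' [hA hA' AA' [Aa Av] [A'a A'v]]]] := facets_av.
have [//|e|e|[e|e|//]] := simple_pigeonhole simpleP vertex_v (conj hF Fv)
  (conj hG Gv) (conj hA Av) (conj hA' A'v).
- by rewrite e in na.
- by rewrite e in na.
- by rewrite e in na'.
- by rewrite e in na'.
Qed.

End TwoEdges.

(** * Deleting one or two consecutive vertices of the cycle *)

Section Shortening.
Variables (g : seq 'rV[R]_3).
Let P := conv_hull g.
Hypotheses (P3 : has_dim P 3) (simpleP : simple_3polytope P).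

Lemma facet_hamiltonian_cycle_rot s k :
  facet_hamiltonian_cycle P s -> facet_hamiltonian_cycle P (rot k s).
Proof.
move=> [[s2 us vs es] hs]; split.
  split.
  - by rewrite size_rot.
  - by rewrite rot_uniq.
  - by move=> v; rewrite mem_rot; exact: vs.
  - by move=> u v; rewrite cycle_edges_rot; exact: es.
move=> F /hs[[v vs' Fv] js]; split; first by exists v; rewrite ?mem_rot.
move=> x y; rewrite !mem_rot => xs ys Fx Fy.
have [q hq lq] := js x y xs ys Fx Fy; exists q => //.
apply: (sub_path _ hq) => a b /asboolP[h1 h2]; apply/asboolP; split=> //.
by rewrite !cycle_edges_rot.
Qed.

(** Common core of both deletions: every facet must keep a vertex, and none may be cut in two. *)
Lemma drop_cycle_facet_hamiltonian s m :
  facet_hamiltonian_cycle P s -> (m < size s)%N ->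
  (forall F, facet P F -> exists i, (m <= i < size s)%N /\ F s`_i) ->
  (forall F, facet P F -> (forall i, (i < size s)%N -> F s`_i) \/
    ~ (F s`_(size s).-1 /\ forall i, (i <= m)%N -> F s`_i)) ->
  facet_hamiltonian_path P (drop m s).
Proof.
move=> [[s2 us vs es] hs] ms meet conn; split.
  split.
  - by rewrite -size_eq0 size_drop subn_eq0 -ltnNge.
  - exact: drop_uniq.
  - by move=> v /mem_drop; exact: vs.
  - by move=> u v /path_edges_drop_cycle; exact: es.
move=> F hF; split.
  have [i [/andP[mi im] Fi]] := meet F hF; exists s`_i => //.
  rewrite -(subnKC mi) -nth_drop; apply: mem_nth.
  by rewrite size_drop ltn_sub2r.
apply: joined_drop_cycle => //.
- move=> u v; apply: (@face_convex _ _ g).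
  by move: hF; rewrite facet_kface // => -[].
- by have [] := hs F hF.
- exact: conn.
Qed.

Section Cycle.
Variables (s : seq 'rV[R]_3).
Hypothesis hs : facet_hamiltonian_cycle P s.

Let s_gt2 : (2 < size s)%N. Proof. by have [[? ? _ _] _] := hs. Qed.

Let s_uniq : uniq s. Proof. by have [[? ? _ _] _] := hs. Qed.

Lemma cycle_adj i j : (i < size s)%N -> j = (i.+1 %% size s)%N ->
  skel_adj P s`_i s`_j.
Proof.
move=> hi ->; have [[_ _ _ es] _] := hs.
by apply: es; apply/cycle_edgesP; exists i.
Qed.

Let adj_last0 : skel_adj P s`_(size s).-1 s`_0.
Proof. by apply: cycle_adj; rewrite prednK ?modnn; size_lia. Qed.

Let adj01 : skel_adj P s`_0 s`_1.
Proof. by apply: cycle_adj; rewrite ?modn_small; size_lia. Qed.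

Let adj12 : skel_adj P s`_1 s`_2.
Proof. by apply: cycle_adj; rewrite ?modn_small; size_lia. Qed.

Let last_neq1 : s`_(size s).-1 != s`_1.
Proof. by rewrite nth_uniq //; size_lia. Qed.

Let neq02 : s`_0 != s`_2.
Proof. by rewrite nth_uniq //; size_lia. Qed.

Let last_lt : ((size s).-1 < size s)%N. Proof. by size_lia. Qed.

Let meet_at F i : facet P F -> F s`_i -> (i < size s)%N ->
  i = 0%N -> F s`_(size s).-1 \/ F s`_1.
Proof.
move=> hF Fi _ e; subst i.
exact: (two_edges_cover P3 simpleP adj_last0 adj01).
Qed.

(** A facet at [s_0] keeps a neighbour of [s_0]; one containing [s_0] and both neighbours is [F0],
    whose trace is the whole cycle. *)
Lemma drop1_facet_hamiltonian F0 : facet P F0 ->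
  (forall i, (i < size s)%N -> F0 s`_i) -> facet_hamiltonian_path P (drop 1 s).
Proof.
move=> hF0 allF0; apply: drop_cycle_facet_hamiltonian => //.
- by size_lia.
- move=> F hF; have [_ /(_ F hF)[[v /(nthP 0)[i hi <-] Fi] _]] := hs.
  have [i0|i0] := posnP i; last by exists i; split=> //; size_lia.
  have [Fl|F1] := meet_at hF Fi hi i0.
    by exists (size s).-1; split=> //; size_lia.
  by exists 1%N; split=> //; size_lia.
- move=> F hF; have [FF0|FF0] := pselect (F = F0); first by left; rewrite FF0.
  right=> -[Fl F01]; apply: FF0.
  apply: (two_edges_facet_inj P3 adj_last0 adj01 last_neq1) => //.
  + exact: F01.
  + exact: F01.
  + by apply: allF0.
  + by apply: allF0; size_lia.
  + by apply: allF0; size_lia.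
Qed.

Lemma drop2_facet_hamiltonian F0 : facet P F0 -> ~ F0 s`_(size s).-1 ->
  F0 s`_0 -> F0 s`_1 -> F0 s`_2 -> facet_hamiltonian_path P (drop 2 s).
Proof.
move=> hF0 F0l F00 F01 F02; apply: drop_cycle_facet_hamiltonian => //.
- move=> F hF; have [_ /(_ F hF)[[v /(nthP 0)[i hi <-] Fi] _]] := hs.
  (* By simplicity [F0] is the only facet at [s_0] avoiding the last vertex, and it contains
     [s_2]. *)
  have at0 : F s`_0 -> F s`_(size s).-1 \/ F s`_2.
    move=> Fz; have [|nFl] := pselect (F s`_(size s).-1); first by left.
    right; suff -> : F = F0 by [].
    exact: (edge_avoiding_facet_inj P3 simpleP adj_last0).
  have : (1 < i)%N \/ F s`_(size s).-1 \/ F s`_2.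
    case: i hi Fi => [|[|i]] hi Fi; [by right; exact: at0| |by left].
    right; have [] := two_edges_cover P3 simpleP adj01 adj12 neq02 hF Fi; last by right.
    exact: at0.
  move=> [i1|[Fl|F2]]; first by exists i; split=> //; size_lia.
    by exists (size s).-1; split=> //; size_lia.
  by exists 2%N; split=> //; size_lia.
(* A facet containing [s_0], [s_1], [s_2] is [F0], which misses the last vertex. *)
- move=> F hF; right=> -[Fl F012]; apply: F0l; suff <- : F = F0 by [].
  by apply: (two_edges_facet_inj P3 adj01 adj12 neq02) => //; exact: F012.
Qed.

(* Moving back along the cycle from a facet containing [s_0, s_1, s_2] until
   the cycle leaves it. *)
Lemma rotation_start F0 j : (j < size s)%N -> ~ F0 s`_j ->
  F0 s`_0 -> F0 s`_1 -> F0 s`_2 ->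
  exists2 k, (k <= size s)%N & [/\ ~ F0 (rot k s)`_(size s).-1,
    F0 (rot k s)`_0, F0 (rot k s)`_1 & F0 (rot k s)`_2].
Proof.
move=> hj nj F00 F01 F02.
(* The largest missing index [i] is taken; rotating by [i.+1] makes it last. *)
pose Q i := (i < size s)%N && `[< ~ F0 s`_i >].
have [|i|i /andP[hi /asboolP ni] imax] := @ex_maxnP Q (size s).
- by exists j; rewrite /Q hj; exact/asboolP.
- by move=> /andP[/ltnW].
have after l : (i < l < size s)%N -> F0 s`_l.
  move=> /andP[il hl]; apply: contrapT => nl.
  by have := imax l; rewrite /Q hl (introT (asboolP _) nl) => /(_ isT); lia.
have next t : (t < 3)%N -> F0 (rot i.+1 s)`_t.
  move=> ht; rewrite nth_rot; [|size_lia|size_lia].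
  have [h|h] := ltnP (i.+1 + t) (size s).
    by rewrite modn_small //; apply: after; lia.
  (* Indices that wrap around land on 0, 1 or 2, where [F0] is known to hold. *)
  have -> : (i.+1 + t = size s + (i.+1 + t - size s))%N by size_lia.
  rewrite modnDl modn_small; last size_lia.
  have : (i.+1 + t - size s < 3)%N by size_lia.
  by case: (_ - _)%N => [|[|[|]]].
exists i.+1 => //; split; try exact: next.
rewrite nth_rot //.
have -> : (i.+1 + (size s).-1 = size s + i)%N by size_lia.
by rewrite modnDl modn_small.
Qed.

End Cycle.

Lemma simple_facet_hamiltonian_path s :
  facet_hamiltonian_cycle P s -> exists p, facet_hamiltonian_path P p.
Proof.
move=> hs; have [[s2 us _ _] _] := hs.
have [[F [hF allF]]|noall] := pselect (exists F, facet P F /\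
    forall i, (i < size s)%N -> F s`_i).
  by exists (drop 1 s); exact: drop1_facet_hamiltonian hF allF.
have adj01 : skel_adj P s`_0 s`_1.
  by apply: (cycle_adj hs); rewrite ?modn_small; size_lia.
have adj12 : skel_adj P s`_1 s`_2.
  by apply: (cycle_adj hs); rewrite ?modn_small; size_lia.
have neq02 : s`_0 != s`_2 by rewrite nth_uniq //; size_lia.
have [F [hF F0 F1 F2]] := two_edges_facet P3 simpleP adj01 adj12.
have [j hj nj] : exists2 j, (j < size s)%N & ~ F s`_j.
  apply: contrapT => no; apply: noall; exists F; split=> // i hi.
  by apply: contrapT => ni; apply: no; exists i.
have [k ks [nl G0 G1 G2]] := rotation_start hs hj nj F0 F1 F2.
exists (drop 2 (rot k s)).
apply: (drop2_facet_hamiltonian (facet_hamiltonian_cycle_rot k hs) hF) => //.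
by rewrite size_rot.
Qed.

End Shortening.
End SimplePolytopes.

(** * The triakis octahedron *)

Section TriakisOctahedron.

(** Integer coordinates let the finite checks run by computation. *)
Definition triple := (int * int * int)%type.
Implicit Types (p q t : triple) (l : seq triple).

Definition zdot p q : int := p.1.1 * q.1.1 + p.1.2 * q.1.2 + p.2 * q.2.
Definition zadd p q : triple := (p.1.1 + q.1.1, p.1.2 + q.1.2, p.2 + q.2).
Definition znorm1 p : nat := (`|p.1.1| + `|p.1.2| + `|p.2|)%N.

Definition axial : seq triple :=
  [:: (5, 0, 0); (0, 5, 0); (-5, 0, 0); (0, -5, 0); (0, 0, 5); (0, 0, -5)].

Definition signs : seq int := [:: 1; -1].

(** The apices of the pyramids: [(2, 2, 2)] lies just beyond the plane [x + y + z = 5] of an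
    octahedron face. *)
Definition cubical : seq triple :=
  [seq (2 * x.1, 2 * x.2, 2 * e) | x <- [seq (a, b) | a <- signs, b <- signs],
                                   e <- signs].

Definition pts : seq triple := axial ++ cubical.

(* The facets are the triangles exposed, at level 10, by these functionals. *)
Definition normals : seq triple :=
  let c := [:: 1; -1; 2; -2] in
  [seq m <- [seq (x, e) | x <- [seq (a, b) | a <- c, b <- c], e <- c] |
    znorm1 m == 5%N].

(* Two vertices are adjacent when their midpoint is not interior to the
   octahedron spanned by [axial]. *)
Definition adj p q : bool := (p != q) && (10 <= znorm1 (zadd p q))%N.

Definition on_facet m p : bool := zdot m p == 10.

Definition avoids m l : bool := ~~ has (on_facet m) l.

(** Paths grow at the head, so testing for a return at the head catches each one as soon as it
    occurs. *)
Definition gap m l : bool :=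
  if l is p :: l' then
    if on_facet m p then has (on_facet m) (drop (find (predC (on_facet m)) l') l')
    else false
  else false.

(* [refuted k l] explores the extensions of the path [l] by at most [k]
   vertices; a gap persists in every extension. The conditionals, unlike [&&]
   and [||], are evaluated lazily by [vm_compute]. *)
Fixpoint refuted k l : bool :=
  if has (gap^~ l) normals then true
  else if has (avoids^~ l) normals then
    if k is k'.+1 then
      all (fun p => if p \in l then true
                    else if adj p (head p l) then refuted k' (p :: l)
                    else true) pts
    else true
  else false.

(** As [pts] has 14 elements, the bound 14 never truncates the search. *)
Lemma all_refuted : all (fun p => refuted 14 [:: p]) pts.
Proof. by vm_compute. Qed.

Definition interrupted m l : Prop := exists i k j,
  [/\ (i < k < j)%N, (j < size l)%N, on_facet m (nth (0, 0, 0) l i),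
      ~~ on_facet m (nth (0, 0, 0) l k) & on_facet m (nth (0, 0, 0) l j)].

Lemma interrupted_cat m l (q : seq triple) : interrupted m l -> interrupted m (q ++ l).
Proof.
move=> [i [k [j [ikj hj oi ok oj]]]].
exists (size q + i)%N, (size q + k)%N, (size q + j)%N.
have e d : nth (0, 0, 0) (q ++ l) (size q + d) = nth (0, 0, 0) l d.
  by rewrite nth_cat ltnNge leq_addr /= addKn.
by rewrite !e size_cat; split=> //; lia.
Qed.

Lemma gap_interrupted m l : gap m l -> interrupted m l.
Proof.
case: l => // p l; rewrite /gap; case: ifP => // op.
set k := find _ l => /(has_nthP (0, 0, 0))[j]; rewrite size_drop nth_drop => hj oj.
have offk : ~~ on_facet m (nth (0, 0, 0) l k).
  apply: (@nth_find _ _ (predC (on_facet m))).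
  by rewrite has_find -subn_gt0; exact: leq_ltn_trans hj.
exists 0%N, k.+1, (k + j).+1; rewrite /=; split=> //; last by rewrite ltnS -ltn_subRL.
(* Offset 0 is the vertex off the facet itself, so the return comes strictly later. *)
case: j => [|j] in hj oj *; last by lia.
by rewrite addn0 (negbTE offk) in oj.
Qed.

Definition unhamiltonian l : Prop :=
  exists2 m, m \in normals & avoids m l \/ interrupted m l.

(** Soundness of the search: [q] is the part still to be prepended, consumed from its last element,
    the one next to the head of [l]. *)
Lemma refutedP k l (q : seq triple) : refuted k l -> l != [::] -> (size q <= k)%N ->
  {subset q <= pts} -> uniq (q ++ l) -> sorted adj (q ++ l) ->
  unhamiltonian (q ++ l).
Proof.
elim: k l q => [|k IH] l q; rewrite /refuted -?/refuted;
  case: ifP => [/hasP[m mN /gap_interrupted gm] _|_].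
- by move=> *; exists m => //; right; exact: interrupted_cat.
- case: ifP => // /hasP[m mN am] _ _; rewrite leqn0 => /nilP-> _ _ _.
  by exists m => //; left.
- by move=> *; exists m => //; right; exact: interrupted_cat.
case: ifP => // /hasP[m mN am].
case: (lastP q) => [|{}q p]; first by move=> *; exists m => //; left.
rewrite size_rcons ltnS cat_rcons => /allP all_l l0 qk qpts ul sl.
apply: IH => //; last by move=> x xq; apply: qpts; rewrite mem_rcons inE xq orbT.
have := all_l p; rewrite qpts ?mem_rcons ?inE ?eqxx // => /(_ isT).
move: ul sl; rewrite cat_uniq /= => /and3P[_ _ /andP[/negbTE-> _]].
case: l l0 {all_l am} => // x l _ /=; rewrite -cat_rcons => sl.
suff -> : adj p x by [].
move: sl; rewrite -[_ :: l]/([:: x] ++ l) catA => /cat_sorted2[].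
by rewrite cats1 -!cats1 -catA => /cat_sorted2[_] /= /andP[].
Qed.

(** * Transfer of the integer computations to real space *)

Section Realization.
Variable R : realType.
Implicit Types (c : 'cV[R]_3) (x y : 'rV[R]_3) (F : set 'rV[R]_3).

Definition vec t : 'rV[R]_3 := \row_j (nth 0 [:: t.1.1; t.1.2; t.2] j)%:~R.
Definition cov t : 'cV[R]_3 := (vec t)^T.

Definition triakis : set 'rV[R]_3 := conv_hull [seq vec t | t <- pts].

Lemma dot_vec c t :
  dot c (vec t) = t.1.1%:~R * c 0 0 + t.1.2%:~R * c 1 0 + t.2%:~R * c 2%:R 0.
Proof.
rewrite dotE !big_ord_recl big_ord0 addr0 !mxE /= addrA.
by congr (_ + _ * c _ _ + _ * c _ _); apply: val_inj.
Qed.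

Lemma dot_cov m p : dot (cov m) (vec p) = (zdot m p)%:~R.
Proof. by rewrite dot_vec !mxE /= !rmorphD !rmorphM /=; ring. Qed.

Lemma vec_add p q : vec (zadd p q) = vec p + vec q.
Proof.
apply/rowP => j; rewrite !mxE -intrD; congr (_%:~R).
by case: j => -[|[|[|j]]].
Qed.

Lemma vec_inj : injective vec.
Proof.
move=> [[a b] d] [[a' b'] d'] /rowP e; congr (_, _, _).
- by have := e 0; rewrite !mxE => /intr_inj.
- by have := e 1; rewrite !mxE => /intr_inj.
- by have := e 2%:R; rewrite !mxE => /intr_inj.
Qed.

Lemma vec_mem p : p \in pts -> triakis (vec p).
Proof. by move=> pp; apply: mem_hull; exact: map_f. Qed.

Lemma cov_le m (b : int) : all (fun p => zdot m p <= b) pts ->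
  {in [seq vec t | t <- pts], forall x, dot (cov m) x <= b%:~R}.
Proof. by move=> /allP h _ /mapP[p /h pb ->]; rewrite dot_cov ler_int. Qed.

Lemma triakis_dim : has_dim triakis 3.
Proof.
have P5 (i : 'I_3) : triakis (0 + row i (5%:M)).
  have -> : 0 + row i (5%:M : 'M[R]_3) =
      vec (nth (0, 0, 0) [:: (5, 0, 0); (0, 5, 0); (0, 0, 5)] i).
    rewrite add0r; apply/rowP => j; rewrite !mxE.
    by case: i => -[|[|[|i]]] //= ?; case: j => -[|[|[|j]]].
  by apply: vec_mem; case: i => -[|[|[|i]]].
have u5 : (5%:M : 'M[R]_3) \in unitmx.
  by rewrite unitmxE det_scalar unitfE expf_neq0 // pnatr_eq0.
exists 0, 5%:M; split=> //.
- by rewrite row_free_unit.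
(* The base point 0 is the midpoint of two opposite octahedron vertices. *)
- have e : vec (5, 0, 0) + vec (-5, 0, 0) = 0.
    by rewrite -vec_add; apply/rowP => -[[|[|[|j]]]] //= hj; rewrite !mxE.
  apply: (@hull_convex _ _ _ (vec (5, 0, 0)) (vec (-5, 0, 0))); try exact: vec_mem.
  apply/segmentP; exists 2^-1; first by lra.
  have -> : vec (-5, 0, 0) = - vec (5, 0, 0) by apply/eqP; rewrite -addr_eq0 addrC e.
  by move: (vec _) => u; apply/rowP => j; rewrite !mxE; lra.
- by move=> y _; rewrite submx_full // row_full_unit.
Qed.

(** A zero functional would expose the whole polytope, of dimension 3. *)
Lemma proper_face_functional k F c b : has_dim F k -> (k < 3)%N ->
  F = triakis `&` [set x | dot c x = b] -> c != 0.
Proof.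
move=> hF k3 eF; apply/eqP => c0.
have d0 x : dot c x = 0 by rewrite c0 /dot mulmx0 mxE.
have [x [_ [_ Fx _ _]]] := hF.
have b0 : b = 0 by move: Fx; rewrite eF => -[_ /= <-].
have e : F = triakis.
  by rewrite eF; apply/seteqP; split=> [y []//|y Py]; split=> //=; rewrite d0 b0.
by move: k3; rewrite (has_dim_uniq triakis_dim (_ : has_dim _ k)) ?ltnn // -e.
Qed.

(** The octahedron vertices bound each coordinate of [c] by [b / 5]; if the 1-norm of [p + q] were
    at most 9, then [c] at [p + q] would be at most [9 * b / 5 < 2 * b]. This covers edges and
    facets alike. *)
Lemma face_adj c b p q : (forall x, triakis x -> dot c x <= b) -> c != 0 ->
  p \in pts -> q \in pts -> dot c (vec p) = b -> dot c (vec q) = b ->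
  p != q -> adj p q.
Proof.
move=> hb c0 pp qp pb qb pq; rewrite /adj pq /= leqNgt; apply/negP => small.
have ax t : t \in pts -> dot c (vec t) <= b by move=> /vec_mem; exact: hb.
have := ax (5, 0, 0) isT; have := ax (-5, 0, 0) isT.
have := ax (0, 5, 0) isT; have := ax (0, -5, 0) isT.
have := ax (0, 0, 5) isT; have := ax (0, 0, -5) isT.
rewrite !dot_vec /= => h1 h2 h3 h4 h5 h6.
have n0 : `|c 0 0| <= b / 5 by rewrite ler_norml; apply/andP; split; lra.
have n1 : `|c 1 0| <= b / 5 by rewrite ler_norml; apply/andP; split; lra.
have n2 : `|c 2%:R 0| <= b / 5 by rewrite ler_norml; apply/andP; split; lra.
have b0 : 0 < b.
  rewrite lt_neqAle; apply/andP; split; last by have := normr_ge0 (c 0 0); lra.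
  apply: contraNneq c0 => b0; apply/eqP/colP => j; rewrite mxE.
  have z (x : R) : `|x| <= b / 5 -> x = 0 by rewrite -b0 mul0r normr_le0 => /eqP.
  case: j => -[|[|[|j]]] // hj.
  - by rewrite -(z _ n0); congr (c _ _); apply: val_inj.
  - by rewrite -(z _ n1); congr (c _ _); apply: val_inj.
  - by rewrite -(z _ n2); congr (c _ _); apply: val_inj.
have : dot c (vec (zadd p q)) <= (znorm1 (zadd p q))%:R * (b / 5).
  rewrite dot_vec /znorm1 !natrD !natr_absz !intr_norm !mulrDl.
  have bound (z : int) (x : R) : `|x| <= b / 5 -> z%:~R * x <= `|z%:~R| * (b / 5).
    move=> hx; apply: le_trans (ler_norm _) _; rewrite normrM.
    by rewrite ler_wpM2l.
  by rewrite !lerD // bound.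
rewrite vec_add dotD pb qb.
have : (znorm1 (zadd p q))%:R <= 9 :> R by rewrite (ler_nat R _ 9) -ltnS.
by nra.
Qed.

(** Equal norms make [p0 + p1] orthogonal to [p1 - p0]; the last condition says that it is not
    orthogonal to [p2 - p0]. Hence the three points are affinely independent, by [row_free2]. *)
Definition triangle m : Prop := exists p0 p1 p2,
  [/\ [/\ p0 \in pts, p1 \in pts & p2 \in pts],
      [/\ zdot m p0 = 10, zdot m p1 = 10 & zdot m p2 = 10],
      p0 != p1, zdot p0 p0 = zdot p1 p1 &
      zdot (zadd p0 p1) p2 != zdot (zadd p0 p1) p0].

Lemma normals_triangle m : m \in normals ->
  all (fun p => zdot m p <= 10) pts /\ triangle m.
Proof.
pose ok m := all (fun p => zdot m p <= 10) pts &&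
  has (fun p0 => has (fun p1 => has (fun p2 =>
    [&& [&& zdot m p0 == 10, zdot m p1 == 10 & zdot m p2 == 10],
        p0 != p1, zdot p0 p0 == zdot p1 p1 &
        zdot (zadd p0 p1) p2 != zdot (zadd p0 p1) p0]) pts) pts) pts.
have /allP okN : all ok normals by vm_compute.
move=> /okN/andP[-> /hasP[p0 h0 /hasP[p1 h1 /hasP[p2 h2]]]].
move=> /and4P[/and3P[/eqP e0 /eqP e1 /eqP e2] n /eqP e ne].
by split=> //; exists p0, p1, p2; split.
Qed.

Lemma zdotC p q : zdot p q = zdot q p.
Proof. by rewrite /zdot; ring. Qed.

Definition normal_facet m : set 'rV[R]_3 :=
  triakis `&` [set x | dot (cov m) x = 10%:~R].

Lemma normal_facet_vec m p : p \in pts -> normal_facet m (vec p) <-> on_facet m p.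
Proof.
move=> pp; split=> [[_ /=]|/eqP h].
  by rewrite dot_cov => /intr_inj/eqP.
by split; [exact: vec_mem|rewrite /= dot_cov h].
Qed.

Lemma normal_facetP m : m \in normals -> facet triakis (normal_facet m).
Proof.
move=> /normals_triangle[hle [p0 [p1 [p2 [[h0 h1 h2] [e0 e1 e2] n e ne]]]]].
exists 2%N; split; first exact: triakis_dim.
have v0 t : vec p0 + (vec t - vec p0) = vec t by rewrite addrC subrK.
apply: (kface2_of_points (x := vec p0) (d := vec p1 - vec p0) (e := vec p2 - vec p0));
  rewrite ?v0 ?dot_cov ?e0 ?e1 ?e2 //; try exact: vec_mem.
- by move=> y; apply: hull_le; exact: cov_le.
- apply/eqP => c0; have := dot_cov m p0.
  by rewrite c0 /dot mulmx0 mxE e0 => /eqP; rewrite eq_sym intr_eq0.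
- apply: (@row_free2 _ _ (cov (zadd p0 p1))).
  + rewrite dotB !dot_cov -rmorphB /=; apply/eqP; rewrite intr_eq0 subr_eq0.
    by move: e; rewrite /zdot /zadd /= => e; apply/eqP; lia.
  + by rewrite subr_eq0 eq_sym; apply/eqP => /vec_inj/eqP; rewrite (negbTE n).
  + by rewrite dotB !dot_cov -rmorphB /= intr_eq0 subr_eq0.
Qed.

(** The first four points of [axial] are listed in cyclic order. *)
Definition equator : seq triple := take 4 pts.

Lemma equator_pts p : p \in equator -> p \in pts.
Proof. exact: mem_take. Qed.

(** The vector [p], read as a functional, reaches its maximum 25 at [p] alone. *)
Lemma equator_vertex p : p \in equator -> vertex triakis (vec p).
Proof.
move=> pE; have pp := equator_pts pE.
have /allP/(_ p pE) : all (fun p => all (fun q => zdot p q <= 25) pts &&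
    all (fun q => (zdot p q == 25) ==> (q == p)) pts && (zdot p p == 25)) equator.
  by vm_compute.
move=> /andP[/andP[le25 /allP eq25] /eqP pp25].
split; last exact: has_dim_set1.
exists (cov p), 25%:~R; split=> [x|]; first by apply: hull_le; exact: cov_le.
apply/seteqP; split=> [_ ->|x [hx /= ex]].
  by split; [exact: vec_mem|rewrite /= -/(dot _ _) dot_cov pp25].
have : (x - vec p <= (0 : 'M[R]_3))%MS.
  apply: hull_eq_sub (cov_le le25) _ hx ex => _ /mapP[q qp ->].
  rewrite dot_cov => /intr_inj/eqP q25.
  by have := eq25 q qp; rewrite q25 => /eqP->; rewrite subrr sub0mx.
by rewrite submx0 subr_eq0 => /eqP.
Qed.

(** Here [p] and [q] are orthogonal, and [p + q] exposes the edge at level 25. *)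
Lemma equator_edge p q : p \in equator -> q \in equator -> adj p q ->
  skel_adj triakis (vec p) (vec q).
Proof.
move=> pE qE pq; have [pp qp] := (equator_pts pE, equator_pts qE).
have /allP/(_ p pE)/allP/(_ q qE) : all (fun p => all (fun q => adj p q ==>
    [&& all (fun t => zdot (zadd p q) t <= 25) pts,
        all (fun t => (zdot (zadd p q) t == 25) ==> ((t == p) || (t == q))) pts,
        all (fun t => zdot p t <= 25) pts, all (fun t => zdot q t <= 25) pts,
        zdot p q == 0, zdot p p == 25 & zdot q q == 25]) equator) equator.
  by vm_compute.
rewrite pq => /and4P[le25 /allP eq25 lep /and4P[leq /eqP e0 /eqP ep /eqP eq]].
have dpp : dot (cov p) (vec p) = 25 by rewrite dot_cov ep.
have dqq : dot (cov q) (vec q) = 25 by rewrite dot_cov eq.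
have dpq : dot (cov p) (vec q) = 0 by rewrite dot_cov e0.
have dqp : dot (cov q) (vec p) = 0 by rewrite dot_cov zdotC e0.
have cE x : dot (cov (zadd p q)) x = dot (cov p) x + dot (cov q) x.
  by rewrite /cov vec_add linearD /= dotDl.
split; try exact: equator_vertex.
have qp0 : vec q - vec p != 0.
  rewrite subr_eq0; apply/eqP => /vec_inj e; move: pq.
  by rewrite e /adj eqxx.
split.
  exists (cov (zadd p q)), 25%:~R; split=> [x|].
    by apply: hull_le; exact: cov_le.
  apply/seteqP; split=> [x xs|x [hx /= ex]].
    split; first by apply: hull_convex xs; exact: vec_mem.
    have /segmentP[t _ ->] := xs.
    by rewrite /= -/(dot _ _) cE !dotD !dotZ !dotB dpp dqq dpq dqp; lra.
  have : (x - vec p <= vec q - vec p)%MS.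
    apply: hull_eq_sub (cov_le le25) _ hx ex => _ /mapP[t tp ->].
    rewrite dot_cov => /intr_inj/eqP t25.
    have := eq25 t tp; rewrite t25 => /orP[]/eqP->; last exact: submx_refl.
    by rewrite subrr sub0mx.
  move=> /sub_rVP[r er].
  have xE : x = vec p + r *: (vec q - vec p) by rewrite -er addrC subrK.
  apply/segmentP; exists r => //.
  (* The bounds for [p] and [q] give [0 <= r] and [r <= 1]. *)
  have := hull_le (cov_le lep) hx; have := hull_le (cov_le leq) hx.
  by rewrite xE !dotD !dotZ !dotB dpp dqq dpq dqp; lra.
exists (vec p), (vec q - vec p); split.
- by rewrite /row_free rank_rV qp0.
- exact: segment_l.
- by move=> i; rewrite ord1 row_id addrC subrK; exact: segment_r.
- by move=> y /segmentP[t _ ->]; rewrite addrC addKr scalemx_sub.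
Qed.

(** Facets are not enumerated: by [face_adj] the points of [pts] on a facet are pairwise [adj],
    which leaves finite checks on pairs and triples. *)
Lemma equator_cycle : facet_hamiltonian_cycle triakis [seq vec p | p <- equator].
Proof.
have cyc : cycle_edges [seq vec p | p <- equator] =
    [seq (vec e.1, vec e.2) | e <- zip equator (rot 1 equator)] by [].
split.
  split=> //.
  - by rewrite (map_inj_uniq vec_inj); vm_compute.
  - by move=> _ /mapP[p /equator_vertex hp ->].
  - move=> u v; rewrite cyc => /mapP[[p q] pq [-> ->]] /=.
    have /allP/(_ _ pq)/and3P[pE qE] : all (fun e => [&& e.1 \in equator,
      e.2 \in equator & adj e.1 e.2]) (zip equator (rot 1 equator)) by vm_compute.
    exact: equator_edge.
move=> F; rewrite (facet_kface _ triakis_dim) => hF.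
have [fF dF] := hF; have [c [b [hb eF]]] := fF.
have c0 : c != 0 by apply: proper_face_functional dF _ eF.
have adjF p q : p \in pts -> q \in pts -> F (vec p) -> F (vec q) -> p != q -> adj p q.
  rewrite eF => pp qp [_ pb] [_ qb]; exact: (face_adj hb c0 pp qp pb qb).
split.
  have [u [v [w [[/mapP[p pp ->] /mapP[q qp ->] /mapP[r rp ->]] [[Fp Fq Fr]]]]]] :=
    face2_three_points hF.
  rewrite !(inj_eq vec_inj) => -[pq pr qr].
  have := adjF _ _ pp qp Fp Fq pq; have := adjF _ _ pp rp Fp Fr pr.
  have := adjF _ _ qp rp Fq Fr qr.
  (* Any three pairwise adjacent points include one of the equator. *)
  have /allP/(_ p pp)/allP/(_ q qp)/allP/(_ r rp) :
    all (fun p => all (fun q => all (fun r => [==> adj q r, adj p r, adj p q =>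
      [|| p \in equator, q \in equator | r \in equator]]) pts) pts) pts by vm_compute.
  move=> + aqr apr apq; rewrite aqr apr apq !implyTb => /or3P[]h.
  - by exists (vec p) => //; exact: map_f.
  - by exists (vec q) => //; exact: map_f.
  - by exists (vec r) => //; exact: map_f.
move=> _ _ /mapP[p pE ->] /mapP[q qE ->] Fp Fq.
have [->|pq] := eqVneq p q; first by exists [::].
have apq := adjF _ _ (equator_pts pE) (equator_pts qE) Fp Fq pq.
(* Adjacent points of the equator are consecutive on the cycle. *)
have /allP/(_ p pE)/allP/(_ q qE) : all (fun p => all (fun q => adj p q ==>
  (((p, q) \in zip equator (rot 1 equator)) ||
   ((q, p) \in zip equator (rot 1 equator)))) equator) equator by vm_compute.
rewrite apq /= => h; exists [:: vec q] => //=; rewrite andbT.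
apply/asboolP; split; last exact: (face_convex fF).
rewrite cyc; case/orP: h => /(map_f (fun e => (vec e.1, vec e.2))); first by left.
by right.
Qed.

Lemma skel_adj_adj p q : p \in pts -> q \in pts ->
  skel_adj triakis (vec p) (vec q) -> adj p q.
Proof.
move=> pp qp pq; have [_ _ [[c [b [hb eF]]] dF]] := pq.
have c0 : c != 0 by apply: proper_face_functional dF _ eF.
have [_ pb] : (triakis `&` [set x | (x *m c) 0 0 = b]) (vec p).
  by rewrite -eF; exact: segment_l.
have [_ qb] : (triakis `&` [set x | (x *m c) 0 0 = b]) (vec q).
  by rewrite -eF; exact: segment_r.
apply: (face_adj hb c0 pp qp pb qb).
by apply: contraNneq (skel_adj_neq pq) => ->.
Qed.

(** An avoided facet has empty trace; an interrupted one contradicts [cut_path]. *)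
Lemma unhamiltonian_path l : {subset l <= pts} -> unhamiltonian l ->
  ~ facet_hamiltonian_path triakis [seq vec p | p <- l].
Proof.
move=> lpts [m mN bad] [[_ ul _ _] /(_ _ (normal_facetP mN))[[_ /mapP[p pl ->] Fp] jl]].
case: bad => [/hasPn/(_ p pl)|[i [k [j [/andP[ik kj] hj oi ok oj]]]]].
  by rewrite (iffLR (normal_facet_vec m (lpts p pl)) Fp).
have at_ d : (d < size l)%N -> nth 0 [seq vec p | p <- l] d = vec (nth (0, 0, 0) l d).
  by move=> hd; rewrite (nth_map (0, 0, 0)).
have on d : (d < size l)%N ->
    normal_facet m (nth 0 [seq vec p | p <- l] d) <-> on_facet m (nth (0, 0, 0) l d).
  by move=> hd; rewrite at_ //; apply/normal_facet_vec/lpts/mem_nth.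
move: ok; apply/negP; rewrite negbK; apply/on; first by lia.
apply: (cut_path (i := i) (j := j) ul jl); rewrite ?size_map ?ik //; apply/on => //.
by lia.
Qed.

Lemma no_facet_hamiltonian_path : ~ exists s, facet_hamiltonian_path triakis s.
Proof.
move=> [s hs]; have [[s0 us vs es] _] := hs.
(* Vertices are among the generators, so the path lifts to integer triples. *)
have [l lpts el] : exists2 l : seq triple, {subset l <= pts} & s = [seq vec p | p <- l].
  have : {subset s <= [seq vec p | p <- pts]}.
    move=> v /vs hv; apply: (vertex_in_hull hv); last exact: vertex_mem.
    by move=> q /mem_hull.
  elim: s {hs s0 us vs es} => [|v s IH] sub; first by exists [::].
  have /mapP[p pp ->] := sub v (mem_head _ _).
  have [q qs|l lpts ->] := IH; first by apply: sub; rewrite inE qs orbT.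
  by exists (p :: l) => // q; rewrite inE => /orP[/eqP->|/lpts].
apply: (unhamiltonian_path lpts); last by rewrite -el.
have ul : uniq l by move: us; rewrite el => /map_uniq.
have sl : sorted adj l.
  apply/(sortedP (0, 0, 0)) => i hi; apply: skel_adj_adj.
  - by apply/lpts/mem_nth/ltnW.
  - exact/lpts/mem_nth.
  have at_ d : (d < size l)%N -> vec (nth (0, 0, 0) l d) = nth 0 s d.
    by move=> hd; rewrite el (nth_map (0, 0, 0)).
  by rewrite !at_ ?(ltnW hi) //; apply/es/path_edges_nth; rewrite el size_map.
have l0 : l != [::] by move: s0; rewrite el; case: (l).
have sz : (size l <= 14)%N by exact: (uniq_leq_size ul lpts).
(* The search starts from the last vertex, since it extends paths at the head. *)
case/lastP: l {el} => [|q p] // in lpts ul sl l0 sz *.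
rewrite -cats1 in lpts ul sl sz *; apply: (@refutedP 14) => //.
- by apply: (allP all_refuted); apply: lpts; rewrite mem_cat inE eqxx orbT.
- by move: sz; rewrite size_cat addn1 => /ltnW.
- by move=> x xq; apply: lpts; rewrite mem_cat xq.
Qed.

End Realization.
End TriakisOctahedron.

Theorem theorem1p7 (R : realType) :
  (forall P : set 'rV[R]_3,
     polytope P -> has_dim P 3 -> simple_3polytope P ->
     (exists c, facet_hamiltonian_cycle P c) ->
     exists p, facet_hamiltonian_path P p) /\
  (exists P : set 'rV[R]_3,
     [/\ polytope P, has_dim P 3, ~ simple_3polytope P,
         exists c, facet_hamiltonian_cycle P c
       & ~ exists p, facet_hamiltonian_path P p]).
Proof.
have simple_path (P : set 'rV[R]_3) : polytope P -> has_dim P 3 ->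
    simple_3polytope P -> (exists c, facet_hamiltonian_cycle P c) ->
    exists p, facet_hamiltonian_path P p.
  by move=> [g ->] P3 simpleP [c]; exact: simple_facet_hamiltonian_path.
split=> //; exists (@triakis R).
have triakisP : polytope (@triakis R) by exists [seq vec R t | t <- pts].
have cyc : exists c, facet_hamiltonian_cycle (@triakis R) c.
  by exists [seq vec R p | p <- equator]; exact: equator_cycle.
split=> //.
- exact: triakis_dim.
(* Were it simple, the first part would turn the equator into a facet-Hamiltonian path. *)
- move=> simple; apply: (@no_facet_hamiltonian_path R).
  by apply: simple_path cyc => //; exact: triakis_dim.
- exact: no_facet_hamiltonian_path.
Qed.
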